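(* Let $P\subseteq\mathbb{R}^n\times\mathbb{R}^d$ be a polytope and let $p_x:\mathbb{R}^n\times\mathbb{R}^d\to\mathbb{R}^n$ be the projection onto the first $n$ coordinates. The pair $(P,p_x)$ has the PF-property if and only if the polytope $P$ is an affinely generated polyhedral relation of type $(n,d)$.
   Context: A polytope is the convex hull of a finite set of points, and $\operatorname{conv}$ denotes the convex hull. Faces of a polytope include the polytope itself (and the empty set is also regarded as a face). The projection $p_x(P)=\{x\in\mathbb{R}^n : \exists y\in\mathbb{R}^d \text{ with } (x,y)\in P\}$ is a polytope. A polytope $P\subseteq\mathbb{R}^n\times\mathbb{R}^d$ together with the projection map $p_x:\mathbb{R}^n\times\mathbb{R}^d\to\mathbb{R}^n$, $(x,y)\mapsto x$, has the PF-property (projected faces property) if for every face $F$ of $P$ the projection $p_x(F)$ is a face of the polytope $p_x(P)$. The polytope $P\subseteq\mathbb{R}^n\times\mathbb{R}^d$ is called a polyhedral relation of type $(n,d)$ generated by affine maps $\rho_1,\ldots,\rho_t:\mathbb{R}^n\to\mathbb{R}^d$ if for every point $x\in p_x(P)$ $$P\cap p_x^{-1}(x)=\operatorname{conv}\{(x,\rho_j(x)) : 1\le j\le t\}.$$ $P$ is an affinely generated polyhedral relation of type $(n,d)$ if there exist finitely many affine maps $\rho_1,\ldots,\rho_t:\mathbb{R}^n\to\mathbb{R}^d$ that generate it in this sense. *)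

(* Defs.v *)
From HB Require Import structures.
From mathcomp Require Import all_boot all_order all_algebra.
From mathcomp Require Import mathcomp_extra boolp classical_sets cardinality.
From mathcomp Require Import reals convex.

Set Implicit Arguments.
Unset Strict Implicit.
Unset Printing Implicit Defensive.

Import Order.TTheory GRing.Theory Num.Theory.

Local Open Scope classical_set_scope.
Local Open Scope ring_scope.

Definition convex_hull (R : realType) (V : lmodType R) (S : set V) : set V :=
  smallest (@convex_set R V) S.

Definition is_polytope (R : realType) (V : lmodType R) (P : set V) : Prop :=
  exists2 S : set V, finite_set S & P = convex_hull S.

(* [f] may be zero: with [b = 0] this makes [P] a face of itself, and with
   [b = 1] it makes the empty set a face. *)
Definition is_face (R : realType) (V : lmodType R) (P F : set V) : Prop :=
  exists (f : {scalar V}) (b : R),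
    (forall z, P z -> f z <= b) /\ F = P `&` [set z | f z = b].

Definition is_affine_map (R : realType) (V W : lmodType R) (g : V -> W) : Prop :=
  exists (l : {linear V -> W}) (c : W), forall x, g x = l x + c.

(* R^n x R^d is the type of pairs of row vectors, so p_x is [fst]. *)
Definition PF_property (R : realType) (n d : nat)
    (P : set ('rV[R]_n * 'rV[R]_d)) : Prop :=
  forall F, is_face P F -> is_face (fst @` P) (fst @` F).

Definition generated_by (R : realType) (n d t : nat)
    (P : set ('rV[R]_n * 'rV[R]_d)) (rho : 'I_t -> 'rV[R]_n -> 'rV[R]_d) : Prop :=
  forall x, (fst @` P) x ->
    P `&` fst @^-1` [set x] = convex_hull (range (fun j : 'I_t => (x, rho j x))).

Definition affinely_generated (R : realType) (n d : nat)
    (P : set ('rV[R]_n * 'rV[R]_d)) : Prop :=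
  exists (t : nat) (rho : 'I_t -> 'rV[R]_n -> 'rV[R]_d),
    (forall j, is_affine_map (rho j)) /\ generated_by P rho.

(* Main.v *)
(* If P is generated by the rho_j and f <= 0 cuts out a face F of P, then p_x(F) is the
   union of the faces {x in p_x(P) : f(x, rho_j x) = 0}; being convex, it equals one of
   them.
   Conversely, under PF every affine h on P has an affine majorant on p_x(P) whose contact
   face projects onto p_x(P). Among the faces projecting onto p_x(P), a minimal one is
   therefore the graph of an affine map. These finitely many maps generate P: a linear
   function separating a point of a fiber from the hull of their values contradicts the
   majorant of that function, as its contact face contains one of the graphs. *)
Require Import Defs.
From HB Require Import structures.
From mathcomp Require Import all_boot all_order all_algebra.
From mathcomp Require Import interval_inference.
From mathcomp Require Import boolp classical_sets cardinality reals convex.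
From mathcomp Require Import ring lra.

Set Implicit Arguments.
Unset Strict Implicit.
Unset Printing Implicit Defensive.

Import Order.TTheory GRing.Theory Num.Theory.

Local Open Scope classical_set_scope.
Local Open Scope ring_scope.

(** * Closure properties of affine maps *)

Lemma linear_is_affine (R : realType) (V W : lmodType R) (f : V -> W) :
  linear f -> is_affine_map f.
Proof.
move=> f_lin; pose fL := GRing.isLinear.Build R V W *:%R f f_lin.
pose l : {linear V -> W} := HB.pack f fL.
by exists l, 0 => x; rewrite addr0.
Qed.

Lemma affine_cst (R : realType) (V W : lmodType R) (c : W) :
  is_affine_map (fun _ : V => c).
Proof. by exists \0, c => x; rewrite add0r. Qed.

Lemma affineD (R : realType) (V W : lmodType R) (f g : V -> W) :
  is_affine_map f -> is_affine_map g -> is_affine_map (fun x => f x + g x).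
Proof.
move=> [l [c fE]] [m [e gE]]; exists (l \+ m), (c + e) => x.
by rewrite fE gE addrACA.
Qed.

Lemma affineZ (R : realType) (V W : lmodType R) (a : R) (f : V -> W) :
  is_affine_map f -> is_affine_map (fun x => a *: f x).
Proof.
by move=> [l [c fE]]; exists (a \*: l), (a *: c) => x; rewrite fE scalerDr.
Qed.

Lemma affineB (R : realType) (V W : lmodType R) (f g : V -> W) :
  is_affine_map f -> is_affine_map g -> is_affine_map (fun x => f x - g x).
Proof.
by move=> fA /(affineZ (-1)) /(affineD fA); under eq_fun do rewrite scaleN1r.
Qed.

Lemma affine_comp (R : realType) (U V W : lmodType R) (f : V -> W) (g : U -> V) :
  is_affine_map f -> is_affine_map g -> is_affine_map (fun x => f (g x)).
Proof.
move=> [l [c fE]] [m [e gE]]; exists (l \o m), (l e + c) => x.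
by rewrite fE gE linearD addrA.
Qed.

Lemma affine_fst (R : realType) (V W : lmodType R) :
  is_affine_map (fst : V * W -> V).
Proof. exact: linear_is_affine. Qed.

Lemma affine_snd (R : realType) (V W : lmodType R) :
  is_affine_map (snd : V * W -> W).
Proof. exact: linear_is_affine. Qed.

Lemma affine_pair (R : realType) (U V W : lmodType R) (f : U -> V) (g : U -> W) :
  is_affine_map f -> is_affine_map g -> is_affine_map (fun x => (f x, g x)).
Proof.
move=> [l [c fE]] [m [e gE]].
have lin : linear (fun x => (l x, m x)) by move=> a x y; rewrite !linearP.
have [k [e' kE]] := affineD (linear_is_affine lin) (affine_cst U (c, e)).
by exists k, e' => x; rewrite -kE fE gE.
Qed.

Lemma affine_row (R : realType) (V : lmodType R) (d : nat)
    (g : 'I_d -> V -> R^o) :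
  (forall k, is_affine_map (g k)) ->
  is_affine_map (fun x => \row_k (g k x : R)).
Proof.
move=> /choice[l] /choice[c gE].
have lin : linear (fun x => \row_k (l k x : R)).
  by move=> a x y; apply/rowP => k; rewrite !mxE linearP.
have [m [e mE]] := affineD (linear_is_affine lin) (affine_cst V (\row_k (c k : R))).
by exists m, e => x; rewrite -mE; apply/rowP => k; rewrite !mxE gE.
Qed.

Lemma affine_mulmx (R : realType) (k : nat) (h : 'cV[R]_k) :
  @is_affine_map R 'rV[R]_k R^o (fun x => (x *m h) 0 0).
Proof.
by apply: linear_is_affine => a x y; rewrite mulmxDl -scalemxAl !mxE.
Qed.

(** * Convex combinations, polytopes and faces *)

Definition weights (R : realType) (I : finType) (lam : I -> R) : Prop :=
  (forall i, 0 <= lam i) /\ \sum_i lam i = 1.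

Lemma affine_comb (R : realType) (V W : lmodType R) (I : finType) (f : V -> W)
    (lam : I -> R) (s : I -> V) :
  is_affine_map f -> weights lam ->
  f (\sum_i lam i *: s i) = \sum_i lam i *: f (s i).
Proof.
move=> [l [c fE]] [_ lam1]; rewrite fE linear_sum -[c in LHS]scale1r -lam1.
rewrite scaler_suml -big_split; apply: eq_bigr => i _ /=.
by rewrite linearZ fE scalerDr.
Qed.

(** A vanishing sum of nonpositive terms has only zero terms. Hence a point of a face is a
    combination of generators on that face alone. *)
Lemma weights_eq0 (R : realType) (I : finType) (lam f : I -> R) :
  weights lam -> (forall i, f i <= 0) -> \sum_i lam i * f i = 0 ->
  forall i, lam i != 0 -> f i = 0.
Proof.
move=> [lam0 _] f0 /eqP sum0 i lami.
have := sum0; rewrite -oppr_eq0 -sumrN psumr_eq0 => [|j _]; last first.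
  by rewrite oppr_ge0 mulr_ge0_le0.
by move=> /allP/(_ i); rewrite mem_index_enum oppr_eq0 mulf_eq0 (negbTE lami) => /(_ isT)/eqP.
Qed.

Lemma weights_neq0 (R : realType) (I : finType) (lam : I -> R) :
  weights lam -> exists i, lam i != 0.
Proof.
move=> [_ lam1]; apply: contrapT => /forallNP lam0.
have /eqP := oner_neq0 R; apply; rewrite -lam1 big1 // => i _.
by have /negP := lam0 i; rewrite negbK => /eqP.
Qed.

Lemma convex_setE (R : realType) (V : lmodType R) (C : set V) :
  @convex_set R V C <->
  forall x y (t : R), 0 <= t -> t <= 1 -> C x -> C y -> C (t *: x + (1 - t) *: y).
Proof.
split=> [CC x y t t0 t1 /mem_set Cx /mem_set Cy | CC x y t /set_mem Cx /set_mem Cy].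
  by have /set_mem := CC _ _ (Itv01 t0 t1) Cx Cy.
by apply/mem_set; exact: CC.
Qed.

Lemma convex_set_comb (R : realType) (V : lmodType R) (C : set V) (I : finType)
    (lam : I -> R) (s : I -> V) :
  @convex_set R V C -> (forall i, lam i != 0 -> C (s i)) -> weights lam ->
  C (\sum_i lam i *: s i).
Proof.
move=> /convex_setE CC Cs [lam0 lam1].
(* The induction runs on normalized partial sums, meaningful only once the accumulated weight [L] is
   nonzero. *)
suff H (r : seq I) : let L := \sum_(i <- r) lam i in
    L != 0 -> C (L^-1 *: \sum_(i <- r) lam i *: s i).
  by have := H (index_enum I); rewrite /= lam1 invr1 scale1r; apply; exact: oner_neq0.
elim: r => [|i r IH] /=; first by rewrite big_nil eqxx.
rewrite !big_cons; set L := \sum_(j <- r) _ in IH *; set z := \sum_(j <- r) _ in IH *.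
have L0 : 0 <= L by exact: sumr_ge0.
have [li0|li0 liL] := eqVneq (lam i) 0; first by rewrite li0 scale0r !add0r.
have [L_eq0|L_neq0] := eqVneq L 0.
  have -> : z = 0.
    rewrite /z big_seq big1 // => j jr; move/eqP: L_eq0.
    by rewrite /L psumr_eq0 // => /allP/(_ _ jr)/eqP ->; rewrite scale0r.
  by rewrite L_eq0 !addr0 scalerA mulVf // scale1r; exact: Cs.
have sum_gt0 : 0 < lam i + L by rewrite lt_neqAle eq_sym liL addr_ge0.
have t0 : 0 <= lam i / (lam i + L) by rewrite divr_ge0 // ltW.
have t1 : lam i / (lam i + L) <= 1 by rewrite ler_pdivrMr // mul1r lerDl.
have := CC (s i) (L^-1 *: z) _ t0 t1 (Cs _ li0) (IH L_neq0).
congr C; rewrite scalerDr !scalerA [_^-1 * lam i]mulrC; congr (_ + _ *: _).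
by field; rewrite liL L_neq0.
Qed.

Lemma convex_hull_rangeP (R : realType) (V : lmodType R) (I : finType) (s : I -> V) z :
  convex_hull (range s) z <->
  exists2 lam : I -> R, weights lam & z = \sum_i lam i *: s i.
Proof.
split=> [|[lam lamW ->]]; last first.
  move=> C [CC sC]; apply: convex_set_comb => // i _; by apply: sC; exists i.
apply: (@smallest_sub _ _ _ [set z | exists2 lam : I -> R, weights lam & z = \sum_i lam i *: s i]).
  apply/convex_setE => x y t t0 t1 [lam [lam0 lam1] ->] [mu [mu0 mu1] ->] /=.
  exists (fun i => t * lam i + (1 - t) * mu i).
    split=> [i|]; first by rewrite addr_ge0 // mulr_ge0 // subr_ge0.
    by rewrite big_split -!mulr_sumr lam1 mu1 /=; ring.
  rewrite !scaler_sumr -big_split; apply: eq_bigr => i _.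
  by rewrite /= !scalerA -scalerDl.
move=> _ [i _ <-] /=; exists (fun j => (j == i)%:R).
  split=> [j|]; first exact: ler0n.
  by rewrite (bigD1 i) //= eqxx big1 ?addr0 // => j /negbTE ->.
rewrite (bigD1 i) //= eqxx scale1r big1 ?addr0 // => j /negbTE ->.
by rewrite scale0r.
Qed.

Lemma polytopeP (R : realType) (V : lmodType R) (P : set V) :
  is_polytope P -> exists m (s : 'I_m -> V), P = convex_hull (range s).
Proof.
move=> [S /finite_seqP[r ->] ->]; exists (size r), (tnth (in_tuple r)).
congr convex_hull; apply/seteqP; split=> [z /= /seq_tnthP[i ->]|_ [i _ <-]].
  by exists i.
exact: mem_tnth.
Qed.

(** With the bound absorbed into an affine function, cutting functions can be composed with affine
    maps and compared with 0. *)
Lemma is_faceE (R : realType) (V : lmodType R) (P F : set V) :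
  is_face P F <-> exists f : V -> R^o,
    [/\ is_affine_map f, forall z, P z -> f z <= 0 & F = P `&` [set z | f z = 0]].
Proof.
split=> [[f [b [fb ->]]]|[f [[l [c fE]] f0 ->]]].
  exists (fun z => f z - b); split.
  - apply: affineB (affine_cst _ _); apply: linear_is_affine => a x y.
    exact: linearP.
  - by move=> z Pz; rewrite subr_le0 fb.
  - congr (_ `&` _); apply/seteqP; split=> z /= /eqP; rewrite ?subr_eq0 => /eqP.
      by move->; rewrite subrr.
    by [].
have lS : scalar (l : V -> R) by move=> a x y; exact: linearP.
pose lL := GRing.isLinear.Build R V R *%R l lS.
pose g : {scalar V} := HB.pack (l : V -> R) lL.
exists g, (- c); split=> [z Pz|].
  by have := f0 z Pz; rewrite fE => h; rewrite -subr_le0 opprK.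
congr (_ `&` _); apply/seteqP; split=> z /=; rewrite fE => /eqP.
  by rewrite addr_eq0 => /eqP.
by move=> h; apply/eqP; rewrite addr_eq0.
Qed.

(** * Farkas alternative and separation from a finite hull *)

(** Induction on the number of generators. A functional [h] that separates [w] from all generators
    but the first, [u], fails only if it is negative at [u]; its kernel then serves to eliminate
    [u]. *)
Lemma farkas (R : realType) (k m : nat) (v : 'I_m -> 'rV[R]_k) (w : 'rV[R]_k) :
  (exists2 lam : 'I_m -> R, forall i, 0 <= lam i & w = \sum_i lam i *: v i) \/
  (exists2 h : 'cV[R]_k, forall i, 0 <= (v i *m h) 0 0 & (w *m h) 0 0 < 0).
Proof.
have mulE (a b : R) (x : 'rV_k) (g h : 'cV_k) :
    (x *m (a *: g + b *: h)) 0 0 = a * (x *m g) 0 0 + b * (x *m h) 0 0.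
  by rewrite mulmxDr -!scalemxAr !mxE.
have mulEl (a : R) (x y : 'rV_k) (h : 'cV_k) :
    ((x - a *: y) *m h) 0 0 = (x *m h) 0 0 - a * (y *m h) 0 0.
  by rewrite mulmxBl -scalemxAl !mxE.
elim: m v w => [|m IH] v w.
  have [->|w0] := eqVneq w 0.
    by left; exists (fun=> 0) => //; rewrite big_ord0.
  (* With no generators the cone is 0, and [- w^T] takes at [w] minus its squared norm. *)
  right; exists (- w^T); first by case.
  rewrite mulmxN !mxE oppr_lt0 lt_neqAle eq_sym.
  have sq (i : 'I_k) : true -> 0 <= w 0 i * w^T i 0 by rewrite mxE -expr2 sqr_ge0.
  rewrite sumr_ge0 // andbT psumr_eq0 //.
  apply: contra w0 => /allP w0; apply/eqP/rowP => i; rewrite mxE.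
  by have := w0 i; rewrite mem_index_enum mxE mulf_eq0 orbb => /(_ isT)/eqP.
pose u := v ord0; pose v' i := v (lift ord0 i).
have [[lam lam0 wE]|[h hv hw]] := IH v' w.
  left; exists (fun i => oapp lam 0 (unlift ord0 i)).
    by move=> i; case: unlift => /=.
  rewrite big_ord_recl unlift_none scale0r add0r wE.
  by apply: eq_bigr => i _; rewrite liftK.
have [hu|hu] := leP 0 ((u *m h) 0 0).
  by right; exists h => // i; case: (unliftP ord0 i) => [j ->|->] //; exact: hv.
pose q (x : 'rV_k) := (x *m h) 0 0 / (u *m h) 0 0.
(* Project along [u] onto the kernel of [h], where the cone has one generator fewer. *)
have [[lam lam0 wE]|[g gv gw]] := IH (fun i => v' i - q (v' i) *: u) (w - q w *: u).
  (* [c] is the multiple of [u] left after undoing the projection: [q w] is a quotient of negatives,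
     and each [q (v' i)] is nonpositive. *)
  left; pose c := q w - \sum_i lam i * q (v' i).
  exists (fun i => oapp lam c (unlift ord0 i)).
    move=> i; case: unlift => //=; rewrite /c subr_ge0.
    apply: (@le_trans _ _ 0).
      apply: sumr_le0 => j _; apply: mulr_ge0_le0 => //.
      by apply: mulr_ge0_le0; [exact: hv|rewrite invr_le0 ltW].
    by rewrite /q nmulr_rge0 // invr_le0 ltW.
  rewrite big_ord_recl unlift_none /= -/u -[LHS](subrK (q w *: u)) wE /c scalerBl scaler_suml.
  under [in RHS]eq_bigr do rewrite liftK /=.
  under [X in X + _ = _]eq_bigr do rewrite scalerBr scalerA.
  rewrite sumrB -addrA [RHS]addrC; congr (_ + _); rewrite addrC; congr (_ - _).
(* This combination is [g] composed with the projection, so it vanishes at [u]. *)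
have g'E (x : 'rV_k) : (x *m (1 *: g + - ((u *m g) 0 0 / (u *m h) 0 0) *: h)) 0 0 =
    ((x - q x *: u) *m g) 0 0.
  by rewrite mulE mulEl /q; ring.
right; exists (1 *: g + - ((u *m g) 0 0 / (u *m h) 0 0) *: h); last by rewrite g'E.
move=> i; case: (unliftP ord0 i) => [j ->|->]; rewrite g'E; first exact: gv.
by rewrite -/u /q divff ?lt_eqF // scale1r subrr mul0mx mxE.
Qed.

(** Prepending a coordinate 1 turns conic combinations into convex ones. In the dual alternative
    this coordinate contributes equally for [y] and each [r i] and cancels; the sign change reverses
    the inequality. *)
Lemma convex_hull_separation (R : realType) (d : nat) (I : finType)
    (r : I -> 'rV[R]_d) (y : 'rV[R]_d) :
  ~ convex_hull (range r) y ->
  exists h : 'cV[R]_d, forall i, (r i *m h) 0 0 < (y *m h) 0 0.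
Proof.
move=> yr; pose one : 'rV[R]_1 := const_mx 1.
have [[lam lam0 wE]|[h hr hy]] :=
    farkas (fun j : 'I_#|I| => row_mx one (r (enum_val j))) (row_mx one y).
  case: yr; apply/convex_hull_rangeP; exists (fun i => lam (enum_rank i)).
    split=> //; have := congr1 (fun v : 'rV_(1 + d) => v 0 (lshift d 0)) wE.
    rewrite row_mxEl mxE summxE => ->; rewrite (reindex (@enum_val I predT)) /=; last first.
      by apply: onW_bij; exact: enum_val_bij.
    by apply: eq_bigr => j _; rewrite enum_valK mxE row_mxEl mxE mulr1.
  apply/rowP => k; have := congr1 (fun v : 'rV_(1 + d) => v 0 (rshift 1 k)) wE.
  rewrite row_mxEr !summxE => ->; rewrite [RHS](reindex (@enum_val I predT)) /=; last first.
    by apply: onW_bij; exact: enum_val_bij.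
  by apply: eq_bigr => j _; rewrite enum_valK [LHS]mxE row_mxEr [RHS]mxE.
exists (- dsubmx h) => i.
move: hy; have := hr (enum_rank i); rewrite enum_rankK -[h]vsubmxK !mul_row_col.
rewrite col_mxKd !mulmxN !mxE.
set a := \sum_j _; set b := \sum_j _; set c := \sum_j _; lra.
Qed.

(** * Convexity of hulls, faces and projections *)

Lemma convex_convex_hull (R : realType) (V : lmodType R) (S : set V) :
  @convex_set R V (convex_hull S).
Proof.
apply/convex_setE => x y t t0 t1 Sx Sy C [CC SC].
by move/convex_setE: (CC); apply=> //; [exact: Sx|exact: Sy].
Qed.

Lemma affine_hull_le0 (R : realType) (V : lmodType R) (I : finType) (s : I -> V)
    (f : V -> R^o) :
  is_affine_map f -> (forall i, f (s i) <= 0) ->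
  forall z, convex_hull (range s) z -> f z <= 0.
Proof.
move=> fA f0 z /convex_hull_rangeP[lam lamW ->]; rewrite affine_comb //.
by apply: sumr_le0 => i _; apply: mulr_ge0_le0 => //; case: lamW.
Qed.

Lemma face_convex (R : realType) (V : lmodType R) (P F : set V) :
  @convex_set R V P -> is_face P F -> @convex_set R V F.
Proof.
move=> /convex_setE PC [f [b [_ ->]]]; apply/convex_setE => x y t t0 t1 [Px fx] [Py fy].
split; first exact: PC.
by rewrite /= linearD !linearZ /= fx fy; ring.
Qed.

Lemma convex_set_fst (R : realType) (V W : lmodType R) (C : set (V * W)) :
  @convex_set R (V * W)%type C -> @convex_set R V (fst @` C).
Proof.
move=> /convex_setE CC; apply/convex_setE => _ _ t t0 t1 [x Cx <-] [y Cy <-].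
by exists (t *: x + (1 - t) *: y) => //; exact: CC.
Qed.

(* If no [f j] vanishes identically on [C], average points of [C] witnessing this: the average
   is in [C], so some [f k] vanishes there, hence at each of the averaged points. *)
Lemma convex_cover_zeros (R : realType) (V : lmodType R) (C : set V) (t : nat)
    (f : 'I_t -> V -> R^o) :
  @convex_set R V C -> C !=set0 -> (forall j, is_affine_map (f j)) ->
  (forall j x, C x -> f j x <= 0) -> (forall x, C x -> exists j, f j x = 0) ->
  exists j, forall x, C x -> f j x = 0.
Proof.
move=> CC [x0 Cx0] fA f0 cover; apply: contrapT => /forallNP noj.
have /choice[x xP] : forall j, exists x, C x /\ f j x <> 0.
  by move=> j; have /existsNP[x /not_implyP[]] := noj j; exists x.
have [j0 _] := cover _ Cx0.
have t_neq0 : t%:R != 0 :> R by rewrite pnatr_eq0; case: t j0 {f fA f0 cover noj x xP} => [[]|].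
have W : weights (fun _ : 'I_t => t%:R^-1 : R).
  split=> [_|]; first by rewrite invr_ge0 ler0n.
  by rewrite sumr_const card_ord -[_ *+ t]mulr_natr mulVf.
have [k fk] : exists k, f k (\sum_j t%:R^-1 *: x j) = 0.
  by apply: cover; apply: (convex_set_comb CC _ W) => j _; case: (xP j).
have [_] := xP k; apply; move: fk; rewrite affine_comb // => fk.
by apply: (weights_eq0 W _ fk); [move=> j; apply: f0; case: (xP j)|rewrite invr_eq0].
Qed.

(** * From affine generators to the PF-property *)

Lemma affinely_generated_PF (R : realType) (n d : nat)
    (P : set ('rV[R]_n * 'rV[R]_d)) :
  @convex_set R ('rV[R]_n * 'rV[R]_d)%type P -> affinely_generated P -> PF_property P.
Proof.
move=> PC [t [rho [rhoA gen]]] F FP.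
have GC := convex_set_fst (face_convex PC FP).
move: FP => /is_faceE[f [fA f0 FE]].
have rhoP x j : (fst @` P) x -> P (x, rho j x).
  move=> Px; suff : (P `&` fst @^-1` [set x]) (x, rho j x) by case.
  by rewrite gen //; apply: sub_gen_smallest; exists j.
have frhoA j : @is_affine_map R 'rV[R]_n R^o (fun x => f (x, rho j x)).
  apply: affine_comp fA (affine_pair _ (rhoA j)); exact: linear_is_affine.
have GP x : (fst @` F) x -> (fst @` P) x.
  by rewrite FE => -[z [Pz _] <-]; exists z.
(* A point of [F] over [x] is a combination of the points [(x, rho j x)]; [f] vanishes at those with
   nonzero weight. *)
have cover x : (fst @` F) x -> exists j, f (x, rho j x) = 0.
  move=> Fx; have Px := GP _ Fx; move: Fx => [z]; rewrite FE => -[Pz fz] zx.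
  have : (P `&` fst @^-1` [set x]) z by split.
  rewrite gen // => /convex_hull_rangeP[lam lamW zE].
  move: fz => /=; rewrite zE affine_comb // => fz.
  have [j lamj] := weights_neq0 lamW; exists j.
  by apply: (weights_eq0 lamW _ fz) => // i; exact/f0/rhoP.
apply/is_faceE; have [F0|/nonemptyPn F0] := pselect (fst @` F !=set0); last first.
  (* The constant -1 cuts out the empty face. *)
  exists (fun=> -1); split; first exact: affine_cst.
    by move=> _ _; rewrite oppr_le0 ler01.
  rewrite F0; apply/seteqP; split=> // x [_ /= /eqP].
  by rewrite oppr_eq0 oner_eq0.
have [j jP] := convex_cover_zeros GC F0 frhoA (fun j x Fx => f0 _ (rhoP x j (GP x Fx))) cover.
exists (fun x => f (x, rho j x)); split=> //.
  by move=> x Px; exact/f0/rhoP.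
apply/seteqP; split=> [x Fx|x [Px fx]]; first by split; [exact: GP|exact: jP].
by exists (x, rho j x) => //; rewrite FE; split=> //; exact: rhoP.
Qed.

(** * Affine majorants under the PF-property *)

(* Start from any affine majorant. While the projection of the face where it is tight
   is a proper face of [fst @` P], add the largest admissible multiple of the affine
   function cutting out that proper face: one more generator becomes tight. *)
Lemma PF_affine_majorant (R : realType) (n d m : nat)
    (s : 'I_m -> 'rV[R]_n * 'rV[R]_d) (F : 'rV[R]_n * 'rV[R]_d -> R^o) :
  PF_property (convex_hull (range s)) -> is_affine_map F ->
  exists g : 'rV[R]_n -> R^o, [/\ is_affine_map g,
    forall i, F (s i) <= g (s i).1 &
    forall x, (fst @` convex_hull (range s)) x ->
      exists z, [/\ convex_hull (range s) z, z.1 = x & F z = g x]].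
Proof.
set P := convex_hull _ => PF FA.
have sP i : P (s i) by apply: sub_gen_smallest; exists i.
(* Induction on a strict bound [k] for the number of generators that are not tight. *)
suff H (k : nat) (g : 'rV[R]_n -> R^o) : is_affine_map g ->
    (forall i, F (s i) <= g (s i).1) ->
    (#|[set i | F (s i) != g (s i).1]%SET| < k)%N ->
    exists g : 'rV[R]_n -> R^o, [/\ is_affine_map g,
      forall i, F (s i) <= g (s i).1 &
      forall x, (fst @` P) x -> exists z, [/\ P z, z.1 = x & F z = g x]].
  apply: (H _ (fun=> \sum_i `|F (s i)|) (affine_cst _ _) _ (ltnSn _)) => i.
  rewrite (bigD1 i) //= (le_trans (ler_norm _)) // lerDl.
  by apply: sumr_ge0 => j _; exact: normr_ge0.
elim: k g => // k IH g gA Fg card.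
pose f z : R^o := F z - g z.1.
have fA : is_affine_map f by exact: affineB FA (affine_comp gA (affine_fst _ _)).
have f0 z : P z -> f z <= 0.
  by apply: affine_hull_le0 => // i; rewrite subr_le0.
have /PF/is_faceE[g' [g'A g'0 fstE]] : is_face P (P `&` [set z | f z = 0]).
  by apply/is_faceE; exists f.
have tight0 i : F (s i) = g (s i).1 -> g' (s i).1 = 0.
  move=> Fi; suff : (fst @` (P `&` [set z | f z = 0])) (s i).1.
    by rewrite fstE => -[].
  by exists (s i) => //; split=> //=; rewrite /f Fi subrr.
(* If [g'] vanishes below every generator, it vanishes on the whole projection, onto which the tight
   face then already projects. *)
have [all0|/existsNP[i0 /eqP i0P]] := pselect (forall i, g' (s i).1 = 0).
  exists g; split=> // x Px.
  suff : (fst @` P `&` [set x | g' x = 0]) x.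
    rewrite -fstE => -[z [Pz /eqP]]; rewrite /f subr_eq0 => /eqP Fz <-.
    by exists z.
  split=> //=; move: Px => [_ /convex_hull_rangeP[lam lamW ->] <-].
  rewrite (affine_comb _ (affine_comp g'A (affine_fst _ _))) // big1 // => i _.
  by rewrite all0 scaler0.
have g'lt0 i : g' (s i).1 != 0 -> g' (s i).1 < 0.
  by move=> g'i; rewrite lt_neqAle g'i g'0 //; exists (s i).
(* Ratio test: [eps] is the least quotient of slack by slope, so [g + eps * g'] still dominates [F]
   and becomes tight at [j]. At tight generators [g'] is zero, so they remain tight. *)
case: (@Order.TotalTheory.arg_minP _ _ _ i0 (fun i => g' (s i).1 != 0)
  (fun i => (g (s i).1 - F (s i)) / - g' (s i).1) i0P) => j g'j jmin.
set eps := _ / _ in jmin.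
have jE : g (s j).1 + eps * g' (s j).1 = F (s j) by rewrite /eps; field.
apply: (IH (fun x => g x + eps *: g' x)); first exact: affineD (affineZ _ g'A).
  move=> i; have [->|g'i] := eqVneq (g' (s i).1) 0; first by rewrite scaler0 addr0.
  have := jmin i g'i; rewrite ler_pdivlMr ?oppr_gt0 ?g'lt0 // mulrN.
  by rewrite /GRing.scale /=; lra.
apply: leq_trans (proper_card _) card; apply/properP; split.
  apply/fintype.subsetP => i; rewrite !inE; apply: contra => /eqP Fi.
  by rewrite (tight0 _ Fi) scaler0 addr0 Fi.
exists j; rewrite !inE; first by apply: contra g'j => /eqP/tight0 ->.
by rewrite negbK; apply/eqP.
Qed.

(** * Minimal spanning faces and the generating maps *)

(** Coding a face that meets every fiber by the indices of its generators makes minimal ones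
    available through [minset] and leaves only finitely many. *)
Definition spanning_face (R : realType) (n d m : nat)
    (s : 'I_m -> 'rV[R]_n * 'rV[R]_d) (J : {set 'I_m}) : Prop :=
  exists f : 'rV[R]_n * 'rV[R]_d -> R^o, [/\ is_affine_map f,
    forall i, f (s i) <= 0, J = [set i | f (s i) == 0]%SET &
    forall x, (fst @` convex_hull (range s)) x ->
      exists z, [/\ convex_hull (range s) z, z.1 = x & f z = 0]].

(** A point of the face over [x] combines only generators indexed by [J], so any affine identity
    valid on these passes to it. The same [z] serves all [F]. *)
Lemma spanning_face_lift (R : realType) (n d m : nat)
    (s : 'I_m -> 'rV[R]_n * 'rV[R]_d) (J : {set 'I_m}) (x : 'rV[R]_n) :
  spanning_face s J -> (fst @` convex_hull (range s)) x ->
  exists z, [/\ convex_hull (range s) z, z.1 = x &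
    forall (W : lmodType R) (F : 'rV[R]_n * 'rV[R]_d -> W), is_affine_map F ->
      (forall i, i \in J -> F (s i) = 0) -> F z = 0].
Proof.
move=> [f [fA f0 -> span]] /span[z [Pz zx fz]]; exists z; split=> // W F FA FJ.
move: Pz fz => /convex_hull_rangeP[lam lamW ->]; rewrite !affine_comb // => fz.
apply: big1 => i _; have [->|lami] := eqVneq (lam i) 0; first by rewrite scale0r.
by rewrite FJ ?scaler0 // inE; apply/eqP/(weights_eq0 lamW f0 fz).
Qed.

Lemma PF_spanning_face (R : realType) (n d m : nat)
    (s : 'I_m -> 'rV[R]_n * 'rV[R]_d) (F : 'rV[R]_n * 'rV[R]_d -> R^o) :
  PF_property (convex_hull (range s)) -> is_affine_map F ->
  exists g : 'rV[R]_n -> R^o, [/\ is_affine_map g,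
    forall z, convex_hull (range s) z -> F z <= g z.1 &
    spanning_face s [set i | F (s i) == g (s i).1]%SET].
Proof.
move=> PF FA; have [g [gA Fg span]] := PF_affine_majorant PF FA.
pose f z : R^o := F z - g z.1.
have fA : is_affine_map f by exact: affineB FA (affine_comp gA (affine_fst _ _)).
have f0 i : f (s i) <= 0 by rewrite subr_le0.
exists g; split=> // [z Pz|]; first by rewrite -subr_le0 (affine_hull_le0 fA f0).
exists f; split=> // [|x /span[z [Pz zx Fz]]].
  by apply/setP => i; rewrite !inE subr_eq0.
by exists z; split=> //; rewrite /f zx Fz subrr.
Qed.

(* Majorize [h + M f], where [f] cuts out [J]: for large [M] the contact face lies
   inside [J], so it equals [J] by minimality. *)
Lemma minimal_spanning_face_affine (R : realType) (n d m : nat)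
    (s : 'I_m -> 'rV[R]_n * 'rV[R]_d) (J : {set 'I_m})
    (h : 'rV[R]_n * 'rV[R]_d -> R^o) :
  PF_property (convex_hull (range s)) ->
  minset (fun J => `[< spanning_face s J >]) J -> is_affine_map h ->
  exists g : 'rV[R]_n -> R^o, is_affine_map g /\
    forall i, i \in J -> h (s i) = g (s i).1.
Proof.
move=> PF Jmin hA; have /asboolP[f [fA f0 JE span]] := minsetp Jmin.
pose C := \sum_i `|h (s i)|.
have hC i : `|h (s i)| <= C.
  by rewrite /C (bigD1 i) //= lerDl sumr_ge0.
have C0 : 0 <= C by exact: sumr_ge0.
(* Each summand alone forces [M * f (s i)] down to at most [- (2 * C + 1)], a drop larger than the
   variation of [h], which is at most [2 * C]. *)
pose M := \sum_(i | i \notin J) (2 * C + 1) / - f (s i).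
have flt0 i : i \notin J -> f (s i) < 0.
  by rewrite JE inE lt_neqAle f0 andbT.
have MP i : i \notin J -> M * f (s i) <= - (2 * C + 1).
  move=> iJ; rewrite lerNr -mulrN -ler_pdivrMr ?oppr_gt0 ?flt0 // /M (bigD1 i) //=.
  rewrite lerDl sumr_ge0 // => j /andP[jJ _].
  by rewrite divr_ge0 ?oppr_ge0 // addr_ge0 // mulr_ge0.
have FA : is_affine_map (fun z => h z + M *: f z) by exact: affineD (affineZ _ fA).
have [g [gA Fg J'S]] := PF_spanning_face PF FA.
set J' := [set i | _]%SET in J'S.
have J'J : J' = J.
  apply: (minsetinf Jmin); first exact/asboolP.
  (* Were such an [s i] tight, [g] would be at most [- C - 1] at [(s i).1]; a point [z] over it with
     [f z = 0] gives [g] at least [h z], hence at least [- C]. *)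
  apply/fintype.subsetP => i; rewrite inE => /eqP iJ'; apply/negPn/negP => iJ.
  have [|z [Pz zi fz]] := span (s i).1.
    by exists (s i) => //; apply: sub_gen_smallest; exists i.
  have hz : - C - h z <= 0.
    apply: (affine_hull_le0 (affineB (affine_cst _ _) hA) _ Pz) => k.
    by have := hC k; rewrite ler_norml => /andP[]; lra.
  have := Fg z Pz; rewrite fz scaler0 addr0 zi -iJ' => hle.
  have := MP i iJ; have := hC i; rewrite ler_norml => /andP[_].
  by move: hle hz; rewrite /GRing.scale /=; lra.
exists g; split=> // i iJ; have : i \in J' by rewrite J'J.
by move: iJ; rewrite JE !inE => /eqP ->; rewrite scaler0 addr0 => /eqP.
Qed.

(** On [J] each coordinate of the second component agrees with an affine function of the first;
    these functions are the entries of [rho]. The last clause lets contact with a majorant pass from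
    the generators in [J] to the graph. *)
Lemma minimal_spanning_face_graph (R : realType) (n d m : nat)
    (s : 'I_m -> 'rV[R]_n * 'rV[R]_d) (J : {set 'I_m}) :
  PF_property (convex_hull (range s)) ->
  minset (fun J => `[< spanning_face s J >]) J ->
  exists rho : 'rV[R]_n -> 'rV[R]_d, is_affine_map rho /\
    forall x, (fst @` convex_hull (range s)) x ->
      convex_hull (range s) (x, rho x) /\
      forall (W : lmodType R) (F : 'rV[R]_n * 'rV[R]_d -> W), is_affine_map F ->
        (forall i, i \in J -> F (s i) = 0) -> F (x, rho x) = 0.
Proof.
move=> PF Jmin.
have /choice[g gP] k : exists g : 'rV[R]_n -> R^o, is_affine_map g /\
    forall i, i \in J -> ((s i).2 0 k : R^o) = g (s i).1.
  apply: (minimal_spanning_face_affine PF Jmin (h := fun z => z.2 0 k)).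
  by apply: linear_is_affine => a x y; rewrite !mxE.
have gA k : is_affine_map (g k) by case: (gP k).
exists (fun x => \row_k (g k x : R)); split=> [|x Px]; first exact: affine_row.
have /asboolP JS := minsetp Jmin.
have [[x' y] [Pz /= zx zJ]] := spanning_face_lift JS Px; subst x'.
suff -> : \row_k (g k x : R) = y by [].
apply/eqP; rewrite -subr_eq0; apply/eqP.
(* The defect [F] vanishes on [J], hence at the lifted point [(x, y)]. *)
pose F (z : 'rV[R]_n * 'rV[R]_d) := \row_k (g k z.1 : R) - z.2.
apply: (zJ _ F); first exact: affineB (affine_comp (affine_row gA) (affine_fst _ _)) (affine_snd _ _).
move=> i iJ; apply/rowP => k; rewrite !mxE.
by have [_ /(_ i iJ) ->] := gP k; rewrite subrr.
Qed.

Lemma PF_affinely_generated (R : realType) (n d m : nat)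
    (s : 'I_m -> 'rV[R]_n * 'rV[R]_d) :
  PF_property (convex_hull (range s)) -> affinely_generated (convex_hull (range s)).
Proof.
move=> PF; pose min := minset (fun J => `[< spanning_face s J >]).
(* One map per minimal spanning face. *)
pose A := [set J | min J]%SET.
have Amin (j : 'I_#|A|) : min (enum_val j) by have := enum_valP j; rewrite inE.
have /choice[rho rhoP] := fun j => minimal_spanning_face_graph PF (Amin j).
exists #|A|, rho; split=> [j|x Px]; first by case: (rhoP j).
have rhoPx j : convex_hull (range s) (x, rho j x) by have [_ /(_ x Px)[]] := rhoP j.
apply/seteqP; split=> [[x' y] [Pz /= x'x]|_ /convex_hull_rangeP[lam lamW ->]]; last first.
  split; first exact: (convex_set_comb (@convex_convex_hull _ _ _) _ lamW).
  rewrite /= (affine_comb _ (affine_fst _ _) lamW) /= -scaler_suml.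
  by case: lamW => _ ->; rewrite scale1r.
subst x'; have [|/convex_hull_separation[h hy]] := pselect (convex_hull (range (rho ^~ x)) y).
  move=> /convex_hull_rangeP[lam lamW ->]; apply/convex_hull_rangeP; exists lam => //.
  apply: (affine_comb _ (_ : is_affine_map (fun y => (x, y))) lamW).
  by apply: affine_pair (affine_cst _ _) _; exact: linear_is_affine.
have FA := affine_comp (affine_mulmx h) (affine_snd 'rV[R]_n 'rV[R]_d).
have [g [gA Fg J0S]] := PF_spanning_face PF FA.
have [J Jmin /fintype.subsetP JJ0] :=
  minset_exists (P := fun J => `[< spanning_face s J >]) (asboolT J0S).
have JA : J \in A by rewrite inE.
(* The map attached to [J] attains [g x] under [h], while [y] yields at most [g x], contrary to the
   strict separation. *)
have [_ /(_ x Px)[_]] := rhoP (enum_rank_in JA J).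
rewrite enum_rankK_in // => /(_ R^o (fun z => (z.2 *m h) 0 0 - g z.1)).
have gfA := affineB FA (affine_comp gA (affine_fst _ _)).
move=> /(_ gfA) /= rho0.
have /eqP : (rho (enum_rank_in JA J) x *m h) 0 0 - g x = 0.
  by apply: rho0 => i /JJ0; rewrite inE => /eqP ->; rewrite subrr.
rewrite subr_eq0 => /eqP hg.
by have := Fg _ Pz; rewrite /= -hg leNgt hy.
Qed.

Theorem theorem9 (R : realType) (n d : nat)
    (P : set ('rV[R]_n * 'rV[R]_d)) (hP : is_polytope P) :
  PF_property P <-> affinely_generated P.
Proof.
have [m [s ->]] := polytopeP hP.
split; first exact: PF_affinely_generated.
exact/affinely_generated_PF/convex_convex_hull.
Qed.
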